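(* Let $\mathcal{D}$ be a sequence of integers greater than or equal to $2$ and let $\alpha$ be a real number such that the pair $(\alpha,\mathcal{D})$ is a counterexample to the mixed Littlewood conjecture, i.e. such that $$\inf_{q\ge1}\; q\cdot\Vert q\alpha\Vert\cdot|q|_{\mathcal{D}}>0,$$ where the infimum is over positive integers $q$. Then the complexity function of $\alpha$ satisfies $$\lim_{n\to+\infty}\bigl(p(n,\alpha)-n\bigr)=+\infty.$$
   Context: $\Vert x\Vert$ denotes the distance from the real number $x$ to the nearest integer. For a sequence $\mathcal{D}=(d_k)_{k\ge1}$ of integers $\ge2$ set $e_0=1$ and $e_n=\prod_{1\le k\le n}d_k$ for $n\ge1$; for a positive integer $q$ set $w_{\mathcal{D}}(q)=\sup\{n\ge0: q\in e_n\mathbf{Z}\}$ and $|q|_{\mathcal{D}}=1/e_{w_{\mathcal{D}}(q)}=\inf\{1/e_n: q\in e_n\mathbf{Z}\}$. A real number $\alpha$ is badly approximable if $\inf_{q\ge1}q\Vert q\alpha\Vert>0$ (equivalently, irrational with bounded partial quotients); since $|q|_{\mathcal{D}}\le1$, any $\alpha$ as in the claim is badly approximable. For a badly approximable $\alpha=[a_0;a_1,a_2,\ldots]$ (continued fraction expansion), the complexity function is $p(n,\alpha)=\mathrm{Card}\{(a_{\ell+1},\ldots,a_{\ell+n}):\ell\ge0\}$, $n\ge1$, the number of distinct blocks of $n$ consecutive letters of the infinite word $a_1a_2\ldots$. *)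

(* Defs.v *)
From mathcomp Require Export all_boot all_order all_algebra finmap.
From mathcomp Require Export all_classical all_reals topology normedtype.

Set Implicit Arguments.
Unset Strict Implicit.
Unset Printing Implicit Defensive.

Import Order.TTheory GRing.Theory Num.Theory.
Import numFieldNormedType.Exports.

Local Open Scope classical_set_scope.
Local Open Scope ring_scope.

Definition dist_int (R : realType) (x : R) : R :=
  inf [set `|x - m%:~R| | m in [set: int]].

(* e_n = d_1 ... d_n; the value d 0 is never used. *)
Definition partial_prod (d : nat -> nat) (n : nat) : nat :=
  (\prod_(1 <= k < n.+1) d k)%N.

Definition pseudo_abs (R : realType) (d : nat -> nat) (q : nat) : R :=
  inf [set ((partial_prod d n)%:R)^-1 | n in [set n | (partial_prod d n %| q)%N]].

Definition mixed_littlewood_counterexample (R : realType)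
    (alpha : R) (d : nat -> nat) : Prop :=
  0 < inf [set q%:R * dist_int (q%:R * alpha) * pseudo_abs R d q
          | q in [set q : nat | (0 < q)%N]].

(* For irrational alpha these are the complete quotients and partial quotients
   of [a_0; a_1, a_2, ...]. For rational alpha the expansion is padded with
   zeros, because 0^-1 = 0. *)
Definition complete_quotient (R : realType) (alpha : R) (n : nat) : R :=
  iter n (fun x : R => (x - (Num.floor x)%:~R)^-1) alpha.

Definition partial_quotient (R : realType) (alpha : R) (n : nat) : int :=
  Num.floor (complete_quotient alpha n).

Definition blocks (R : realType) (alpha : R) (n : nat) : set (n.-tuple int) :=
  [set [tuple partial_quotient alpha (l + i.+1) | i < n] | l in [set: nat]].
Arguments blocks {R} alpha n.

(* fset_set is empty on infinite sets, so the complexity would be 0 there; for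
   badly approximable alpha the partial quotients are bounded and the set of
   blocks is finite. *)
Definition complexity (R : realType) (n : nat) (alpha : R) : nat :=
  #|` fset_set (blocks alpha n)|%fset.

(* Main.v *)
(* Along a tail of the continued fraction of alpha which is recurrent, the
   denominators modulo e return to their initial residues. A fixed combination
   of two consecutive convergents then has a denominator divisible by e and
   approximates alpha with a quality independent of e; letting e run through
   the e_N contradicts the counterexample property. So no tail is recurrent:
   for every m some word occurs at m and never later. For large n the windows
   of length n starting at 1, ..., m are then pairwise distinct and do not occur
   in the tail after m, which has more than n factors of length n by
   Morse-Hedlund; hence p(n, alpha) - n is eventually at least m. *)
Require Import Defs.
From mathcomp Require Import ring.
Import Order.TTheory GRing.Theory Num.Theory.
Import numFieldNormedType.Exports.
Local Open Scope classical_set_scope.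
Local Open Scope ring_scope.

Set Implicit Arguments.
Unset Strict Implicit.
Unset Printing Implicit Defensive.

(** * Words, factors and recurrence *)

Definition window (T : Type) (x : nat -> T) (l n : nat) : n.-tuple T :=
  [tuple x (l + i)%N | i < n].

Definition factors (T : Type) (x : nat -> T) (N n : nat) : set (n.-tuple T) :=
  [set window x l n | l in [set l | (N <= l)%N]].
Arguments factors {T} x N n.

(** One return of each prefix suffices: every factor of the tail lies in a prefix, and returns of
    longer prefixes give further returns of shorter ones. *)
Definition recurrent_from (T : Type) (x : nat -> T) (m : nat) : Prop :=
  forall n, exists2 k, (0 < k)%N & window x (m + k) n = window x m n.

Lemma window_eqP (T : Type) (x : nat -> T) (l l' n : nat) :
  window x l n = window x l' n <->
  forall i, (i < n)%N -> x (l + i)%N = x (l' + i)%N.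
Proof.
split=> [e i ilt|e].
  by have := congr1 (fun t => tnth t (Ordinal ilt)) e; rewrite !tnth_mktuple.
by apply: eq_from_tnth => i; rewrite !tnth_mktuple e.
Qed.

Lemma factors_recl (T : Type) (x : nat -> T) (N n : nat) :
  factors x N n = window x N n |` factors x N.+1 n.
Proof.
apply/seteqP; split=> [_ [l /= lN <-]|t [->|[l /= lN <-]]].
- move: lN; rewrite leq_eqVlt => /predU1P[->|lN]; first by left.
  by right; exists l.
- by exists N => /=.
- by exists l => //=; apply: ltnW.
Qed.

Lemma factors_bounded (x : nat -> int) (B N n : nat) :
  (forall l, (N <= l)%N -> 0 <= x l < B%:Z) -> finite_set (factors x N n).
Proof.
move=> xB.
pose f (t : n.-tuple 'I_B) : n.-tuple int := [tuple Posz (tnth t i) | i < n].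
apply: (@sub_finite_set _ _ (f @` setT)); last exact/finite_image/finite_finset.
move=> _ [l /= lN <-].
have h (i : 'I_n) : (`|x (l + i)%N| < B)%N.
  have /andP[x0 xltB] := xB (l + i)%N (leq_trans lN (leq_addr _ _)).
  by rewrite -ltz_nat gez0_abs.
exists [tuple Ordinal (h i) | i < n] => //.
apply: eq_from_tnth => i; rewrite !tnth_mktuple /= gez0_abs //.
by have /andP[] := xB (l + i)%N (leq_trans lN (leq_addr _ _)).
Qed.

Section Complexity.
Variables (T : choiceType) (x : nat -> T) (N : nat).
Hypothesis fin : forall n, finite_set (factors x N n).

Lemma repeated_factor (n : nat) : exists2 l, (N <= l)%N &
  exists2 k, (0 < k)%N & window x (l + k) n = window x l n.
Proof.
apply: contrapT => H; apply: infinite_nat.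
(* Without a repetition, sending a position to its window would inject the naturals into a finite
   set. *)
suff -> : [set: nat] = (fun l => window x (N + l) n) @^-1` factors x N n.
  apply: finite_preimage => // l l' _ _ /= e.
  by case: (ltngtP l l') => // ll; case: H;
    [exists (N + l)%N; rewrite ?leq_addr//; exists (l' - l)%N
    |exists (N + l')%N; rewrite ?leq_addr//; exists (l - l')%N];
    rewrite ?subn_gt0// -addnA subnKC// ltnW.
by apply/seteqP; split=> // l _; exists (N + l)%N => //=; rewrite leq_addr.
Qed.

(* Morse-Hedlund: if the number of factors stops growing, then each factor
   determines the next letter, and a repeated factor makes the word periodic. *)
Lemma card_factors_gt (n : nat) :
  (forall m, (N <= m)%N -> ~ recurrent_from x m) ->
  (n < #|` fset_set (factors x N n)|)%N.
Proof.
move=> nrec; elim: n => [|n IHn].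
  rewrite cardfs_gt0; apply/fset0Pn; exists (window x N 0).
  by rewrite (in_fset_set (fin 0)); apply: mem_set; exists N => /=.
apply: leq_ltn_trans IHn _.
pose f (t : n.+1.-tuple T) : n.-tuple T :=
  [tuple tnth t (widen_ord (leqnSn n) i) | i < n].
have fE l : f (window x l n.+1) = window x l n.
  by apply: eq_from_tnth => i; rewrite !tnth_mktuple.
have -> : factors x N n = f @` factors x N n.+1.
  apply/seteqP; split=> [_ [l lN <-]|_ [_ [l lN <-] <-]].
    by exists (window x l n.+1); [exists l | rewrite fE].
  by exists l; rewrite ?fE.
(* Truncation [f] is onto, so the count can fail to grow only if [f] is injective. *)
rewrite (fset_set_image _ (fin _)) ltn_neqAle leq_imfset_card andbT.
apply/negP => /card_in_imfsetP finj.
have {}finj l l' : (N <= l)%N -> (N <= l')%N -> window x l n = window x l' n ->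
    x (l + n)%N = x (l' + n)%N.
  move=> lN l'N e.
  suff /window_eqP : window x l n.+1 = window x l' n.+1 by apply.
  by apply: finj; rewrite ?fE ?(in_fset_set (fin _)) //; apply: mem_set;
    [exists l | exists l'].
have [l lN [k k0 e]] := repeated_factor n.
apply: (nrec l lN) => m; exists k => //.
have key j : window x (l + k + j) n = window x (l + j) n.
  elim: j => [|j IHj]; first by rewrite !addn0.
  apply/window_eqP => i; rewrite !addnS !addSn -!addnS leq_eqVlt.
  case/predU1P => [-> | ]; last by move/window_eqP: IHj; apply.
  by apply: (finj _ _ _ _ IHj); rewrite -?addnA (leq_trans lN) ?leq_addr.
apply/window_eqP => i _; case: (ltnP i n) => [|/subnK <-].
  by move/window_eqP: e; apply.
by rewrite !addnA; apply: (finj _ _ _ _ (key _));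
  rewrite -?addnA (leq_trans lN) ?leq_addr.
Qed.

End Complexity.

(** Induction on [j] moves the start back from [m.+1] to 1. Each window met contains the length-[l]
    word at [m] that never returns, so it is a new factor. *)
Lemma card_factors_unbounded (T : choiceType) (x : nat -> T) (N0 : nat) :
  (forall N n, (0 < N)%N -> finite_set (factors x N n)) ->
  (forall m, (N0 < m)%N -> ~ recurrent_from x m) ->
  forall K, exists n0, forall n, (n0 <= n)%N ->
    (n + K <= #|` fset_set (factors x 1 n)|)%N.
Proof.
move=> fin nrec K; pose m := (N0 + K).+1.
have /existsNP[l nl] := nrec m (leq_addr _ _).
exists (m + l)%N => n mln.
suff H j : (j <= m)%N -> (n + j < #|` fset_set (factors x (m.+1 - j) n)|)%N.
  have := H m (leqnn _); rewrite subSnn; apply: leq_trans.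
  by rewrite leqW // leq_add2l leqW // leq_addl.
elim: j => [_|j IHj jm].
  rewrite addn0 subn0; apply: card_factors_gt => [n'|m' mm']; first exact: fin.
  by apply: nrec; rewrite (leq_trans _ mm') // ltnS leqW // leq_addr.
have jm' := ltnW jm.
rewrite subSS factors_recl -subSn // fset_setU1; last first.
  by apply: fin; rewrite subn_gt0 ltnS.
rewrite cardfsU1 addnS -add1n leq_add ?IHj // lt0b in_fset_set; last first.
  by apply: fin; rewrite subn_gt0 ltnS.
apply/negP; move=> /set_mem[l' /= ml' e]; apply: nl.
exists (l' - (m - j))%N; first by rewrite subn_gt0; rewrite subSn in ml'.
apply/window_eqP => i il.
have := (window_eqP _ _ _ _).1 e (j + i)%N.
have -> : (m - j + (j + i) = m + i)%N by rewrite addnA subnK.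
move=> <-; last by rewrite (leq_trans _ mln) // -addnS leq_add.
have lmj : (m - j <= l')%N by rewrite subSn in ml' => //; apply: ltnW.
congr x; rewrite addnA; congr (_ + _)%N.
by rewrite -{1}(subnK jm') -addnA addnCA subnKC // addnC.
Qed.

(** * Products along a recurrent sequence *)

(* Furstenberg's argument for finite group extensions: if the prefix of length
   L j reappears at position k j and L j.+1 = k j + L j, then
   P (L j) = P (L j - L i) * P (L i) for i <= j, where P is the prefix product,
   and by pigeonhole P (L i) = P (L j) for some i < j. *)
Lemma recurrent_prod_eq1 (R : finUnitRingType) (h : nat -> R) (m : nat) :
  (forall i, h i \is a GRing.unit) -> recurrent_from h m ->
  exists2 n, (0 < n)%N & \prod_(i < n) h (m + i)%N = 1.
Proof.
move=> hU rec; pose P n := \prod_(i < n) h (m + i)%N.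
have PU n : P n \is a GRing.unit by apply: rpred_prod.
have [k k0 ke] : exists2 k : nat -> nat, (forall l, 0 < k l)%N &
    forall l, window h (m + k l) l = window h m l.
  suff /choice[k kP] : forall l, exists k, (0 < k)%N /\
      window h (m + k) l = window h m l.
    by exists k => l; have [] := kP l.
  by move=> l; have [k] := rec l; exists k.
have PD l r : (r <= l)%N -> P (k l + r)%N = P (k l) * P r.
  move=> rl; rewrite /P big_split_ord; congr (_ * _); apply: eq_bigr => i _.
  by rewrite /= addnA; move/window_eqP: (ke l); apply; apply: leq_trans rl.
pose L j := iter j (fun l => k l + l)%N 0%N.
have LS j : L j.+1 = (k (L j) + L j)%N by [].
have Lmono i r : (L i <= L (i + r))%N.
  by elim: r => [|r IH]; rewrite ?addn0 // addnS LS (leq_trans IH) // leq_addl.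
have PL i r : P (L (i + r)%N) = P (L (i + r) - L i)%N * P (L i).
  elim: r => [|r IH]; first by rewrite addn0 subnn /P big_ord0 mul1r.
  rewrite addnS LS PD // -addnBA // PD ?leq_subr // -mulrA -IH //.
suff [i [r r0 e]] : exists i, exists2 r, (0 < r)%N & P (L (i + r)%N) = P (L i).
  exists (L (i + r) - L i)%N.
    rewrite subn_gt0; case: r r0 {e} => // r _.
    by rewrite addnS LS -add1n leq_add.
  by apply: (mulIr (PU (L i))); rewrite mul1r -PL.
apply: contrapT => H; apply: infinite_nat.
suff -> : [set: nat] = (P \o L) @^-1` setT.
  apply: finite_preimage; last exact: finite_finset.
  move=> i j _ _ /= e.
  by case: (ltngtP i j) => // ij; case: H;
    [exists i, (j - i)%N|exists j, (i - j)%N];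
    rewrite ?subn_gt0 // subnKC // ltnW.
by apply/seteqP; split.
Qed.

(** * Continuants and convergents *)

(** [u] and [v] are the values at indices 0 and -1. *)
Fixpoint continuant (a : nat -> int) (u v : int) (n : nat) : int :=
  match n with
  | 0%N => u
  | n'.+1 => match n' with
             | 0%N => a 1%N * u + v
             | n''.+1 => a n * continuant a u v n' + continuant a u v n''
             end
  end.

Definition cf_num (a : nat -> int) := continuant a (a 0%N) 1.
Definition cf_den (a : nat -> int) := continuant a 1 0.

Lemma cf_denSS a n : cf_den a n.+2 = a n.+2 * cf_den a n.+1 + cf_den a n.
Proof. by []. Qed.

Lemma cf_numSS a n : cf_num a n.+2 = a n.+2 * cf_num a n.+1 + cf_num a n.
Proof. by []. Qed.

Lemma cf_den1 a : cf_den a 1 = a 1%N.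
Proof. by rewrite /cf_den /= mulr1 addr0. Qed.

Lemma cf_det a n :
  cf_den a n.+1 * cf_num a n - cf_den a n * cf_num a n.+1 = (-1) ^+ n.+1.
Proof.
elim: n => [|n IHn]; first by rewrite /cf_den /cf_num /=; ring.
by rewrite cf_denSS cf_numSS exprS -IHn; ring.
Qed.

Lemma cf_den_gt0 a n : (forall i, (0 < i)%N -> 1 <= a i) -> 0 < cf_den a n.
Proof.
move=> a1; suff /andP[] : (0 < cf_den a n) && (0 < cf_den a n.+1) by [].
elim: n => [|n /andP[d0 d1]].
  by rewrite cf_den1 ltr01 (lt_le_trans _ (a1 1%N _)).
by rewrite d1 cf_denSS addr_gt0 // mulr_gt0 // (lt_le_trans _ (a1 _ _)).
Qed.

Lemma cf_den_leS a n : (forall i, (0 < i)%N -> 1 <= a i) ->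
  cf_den a n <= cf_den a n.+1.
Proof.
move=> a1; case: n => [|n]; first by rewrite cf_den1 a1.
by rewrite cf_denSS ler_wpDr ?ler_peMl ?a1 ?ltW ?cf_den_gt0.
Qed.

(** The indices are shifted because denominators 0 and 1 coincide when [a 1] is 1. *)
Lemma cf_den_lt a m n : (forall i, (0 < i)%N -> 1 <= a i) -> (m < n)%N ->
  cf_den a m.+1 < cf_den a n.+1.
Proof.
move=> a1; apply: (@homo_ltn _ (fun i => cf_den a i.+1) _ lt_trans) => i.
by rewrite cf_denSS ltr_pwDr ?ler_peMl ?a1 ?ltW ?cf_den_gt0.
Qed.

(** * Denominators modulo e *)

(** One step of the recurrence: the row [(y, z)] times this matrix is [(c y + z, y)]. *)
Definition cf_mx (R : pzRingType) (c : int) : 'M[R]_2 :=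
  \matrix_(i, j) (if (i == 0) && (j == 0) then c%:~R else (i != j)%:R).

Lemma cf_mx_unit (R : comUnitRingType) (c : int) : cf_mx R c \is a GRing.unit.
Proof.
apply/unitrP.
exists (\matrix_(i, j) (if (i != 0) && (j != 0) then - c%:~R else (i != j)%:R)).
split; apply/matrixP => i j; rewrite !mxE !big_ord_recl big_ord0 !mxE /=;
case: i => [[|[|i]]] // ?; case: j => [[|[|j]]] // ?; rewrite /= ?eqxx; by ring.
Qed.

(** The step leaving the pair at [m.+1], [m] uses the letter [m.+2]; hence the offset in the
    recurrence hypotheses below. *)
Lemma cf_den_mx (R : comUnitRingType) a m n :
  (\row_(j < 2) (cf_den a (m + n + (j == 0)))%:~R : 'rV[R]_2) =
  (\row_(j < 2) (cf_den a (m + (j == 0)))%:~R) *m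
    (\prod_(i < n) cf_mx R (a (m.+2 + i)%N)).
Proof.
elim: n => [|n IHn]; first by rewrite big_ord0 addn0 mulmx1.
rewrite big_ord_recr /= -[_ * _]/(_ *m _) mulmxA -IHn.
apply/rowP => j; rewrite !mxE !big_ord_recl big_ord0 !mxE /= addr0.
case: j => [[|[|j]]] // ?; rewrite /= ?addn1 ?addn0 ?addnS.
  by rewrite cf_denSS rmorphD rmorphM /= !addSn; ring.
by ring.
Qed.

Lemma intr_Zp_eq0 (e : nat) (z : int) : (1 < e)%N ->
  ((z%:~R : 'Z_e) == 0) = (e %| `|z|)%N.
Proof.
move=> e1; have H (k : nat) : ((k%:R : 'Z_e) == 0) = (e %| k)%N.
  by rewrite -val_eqE /= val_Zp_nat.
rewrite {1}(intEsign z) rmorphM /= rmorph_sign mulr_sign; case: ifP => _.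
  by rewrite oppr_eq0 H.
exact: H.
Qed.

(** The step matrices lie in a finite ring over ['Z_e]; when their product is 1, the two pairs of
    denominators agree modulo [e] and their determinant vanishes. *)
Lemma cf_den_return a m e : (1 < e)%N -> recurrent_from a m.+2 ->
  exists2 n, (0 < n)%N &
    (e %| `|(cf_den a m * cf_den a (m + n).+1
             - cf_den a m.+1 * cf_den a (m + n))%R|)%N.
Proof.
move=> e1 rec.
have [|k|n n0 P1] := @recurrent_prod_eq1 _ (cf_mx 'Z_e \o a) m.+2.
- by move=> i; apply: cf_mx_unit.
- have [l l0 /window_eqP w] := rec k; exists l => //.
  by apply/window_eqP => i ik /=; rewrite w.
exists n => //; have := cf_den_mx 'Z_e a m n; rewrite P1 mulmx1 => /rowP H.
have := H 0; have := H 1; rewrite !mxE /= !addn0 !addn1 => E0 E1.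
by rewrite -intr_Zp_eq0 // rmorphB !rmorphM /= E0 E1 mulrC subrr.
Qed.

(** * The counterexample inequality *)

Lemma partial_prod_ge (d : nat -> nat) n :
  (forall k, (1 <= k)%N -> (2 <= d k)%N) -> (2 ^ n <= partial_prod d n)%N.
Proof.
move=> hd; elim: n => [|n IHn]; first by rewrite /partial_prod big_geq.
by rewrite /partial_prod big_nat_recr //= expnSr leq_mul // hd.
Qed.

Lemma counterexample_bound (R : realType) (alpha : R) (d : nat -> nat) :
  mixed_littlewood_counterexample alpha d ->
  exists2 c : R, 0 < c & forall (q p : int) n, q != 0 ->
    (partial_prod d n %| `|q|)%N ->
    c <= `|q%:~R| * `|q%:~R * alpha - p%:~R| / (partial_prod d n)%:R.
Proof.
move=> c0; exists (inf [set q%:R * dist_int (q%:R * alpha) * pseudo_abs R d q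
          | q in [set q : nat | (0 < q)%N]]) => // q p n q0 eq.
have dist0 (y : R) : 0 <= dist_int y.
  by apply: lb_le_inf => [|_ [m _ <-]//]; exists `|y - 0%:~R|, 0.
have abs0 k : 0 <= pseudo_abs R d k.
  apply: lb_le_inf => [|_ [m _ <-]]; last by rewrite invr_ge0.
  by exists (partial_prod d 0)%:R^-1, 0%N => //=; rewrite /partial_prod big_geq.
have dist_le (y : R) (m : int) : dist_int y <= `|y - m%:~R|.
  apply: ge_inf; last by exists m.
  by exists 0 => _ [k _ <-].
have abs_le : pseudo_abs R d `|q|%N <= (partial_prod d n)%:R^-1.
  apply: ge_inf; last by exists n.
  by exists 0 => _ [k _ <-]; rewrite invr_ge0.
apply: (@le_trans _ _ (`|q|%N%:R * dist_int (`|q|%N%:R * alpha)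
                        * pseudo_abs R d `|q|%N)).
  apply: ge_inf; last by exists `|q|%N => //=; rewrite absz_gt0.
  by exists 0 => _ [k _ <-]; rewrite !mulr_ge0.
have qE : `|q%:~R : R| = `|q|%N%:R by rewrite -intr_norm natr_absz.
rewrite -qE ler_pM ?mulr_ge0 // ler_wpM2l // qE.
(* The sign of [q] is free; a negative one is absorbed by passing to [- p]. *)
have [q_ge0|q_lt0] := leP 0 q.
  rewrite (_ : `|q|%N%:R = q%:~R :> R) ?dist_le //.
  by rewrite natr_absz ger0_norm.
apply: (le_trans (dist_le _ (- p))).
rewrite (_ : `|q|%N%:R = - q%:~R :> R); last first.
  by rewrite natr_absz ltr0_norm // rmorphN.
by rewrite rmorphN mulNr -opprD normrN.
Qed.

(** * Continued fraction of an irrational number *)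

Definition irrational (R : realType) (x : R) : Prop :=
  forall q p : int, q != 0 -> q%:~R * x != p%:~R.

Section ContinuedFraction.
Variables (R : realType) (alpha : R).
Hypothesis irr : irrational alpha.

Let x := complete_quotient alpha.
Let a := partial_quotient alpha.
Let P := cf_num a.
Let Q := cf_den a.

Let xS n : x n.+1 = (x n - (a n)%:~R)^-1. Proof. by []. Qed.

(** A relation [q x_(n+1) = p] unfolds to [p x_n = q + p a_n]. Irrationality keeps the inverse away
    from its default value at 0. *)
Lemma complete_quotient_irrational n : irrational (complete_quotient alpha n).
Proof.
elim: n => [//|n IHn] q p q0; rewrite -/(x _) xS.
have f0 : x n - (a n)%:~R != 0.
  by rewrite subr_eq0 -[x n]mul1r; apply: (IHn 1).
apply/eqP => e.
have {}e : q%:~R = p%:~R * (x n - (a n)%:~R) by rewrite -e mulfVK.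
have p0 : p != 0.
  by apply: contra_neq q0 => p0; apply/eqP; rewrite -(intr_eq0 R) e p0 mul0r.
have /eqP[] := IHn p (q + p * a n) p0.
rewrite rmorphD rmorphM /= e -/(x n); ring.
Qed.

Let frac_gt0 n : 0 < x n - (a n)%:~R.
Proof.
rewrite lt_neqAle subr_ge0 floor_le andbT eq_sym subr_eq0 -[x n]mul1r.
exact: (@complete_quotient_irrational n 1).
Qed.

Let frac_lt1 n : x n - (a n)%:~R < 1.
Proof. by rewrite ltrBlDl; have := floorD1_gt (x n); rewrite rmorphD. Qed.

Let xS_gt1 n : 1 < x n.+1.
Proof. by rewrite xS invf_gt1. Qed.

Lemma partial_quotient_ge1 n : (0 < n)%N -> 1 <= partial_quotient alpha n.
Proof. by case: n => // n _; rewrite floor_ge_int ltW. Qed.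

Let theta n : R := (Q n)%:~R * alpha - (P n)%:~R.

Let thetaS n : theta n.+1 = - theta n / x n.+2.
Proof.
rewrite xS invrK; elim: n => [|n IHn].
  rewrite /theta /P /Q /cf_num /cf_den /= !rmorphD !rmorphM /=.
  have := gt_eqF (frac_gt0 0%N).
  rewrite -[Num.floor alpha]/(a 0%N) -[alpha]/(x 0%N) => f0.
  by field; rewrite f0.
have -> : theta n.+2 = (a n.+2)%:~R * theta n.+1 + theta n.
  by rewrite /theta /Q /P cf_denSS cf_numSS !rmorphD !rmorphM /=; ring.
have f0 := gt_eqF (frac_gt0 n.+1).
have -> : theta n = - theta n.+1 * x n.+2.
  by rewrite [x n.+2]xS IHn; field; rewrite f0.
ring.
Qed.

(** By [thetaS] consecutive errors alternate in sign, so the two terms of the determinant identity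
    add up in absolute value to 1. *)
Lemma cf_den_approx n :
  (Q n.+1)%:~R * `|(Q n)%:~R * alpha - (P n)%:~R| <= 1.
Proof.
have Q0 k : 0 < (Q k)%:~R :> R.
  by rewrite ltr0z cf_den_gt0 //; apply: partial_quotient_ge1.
have x0 : 0 < x n.+2 := lt_trans ltr01 (xS_gt1 _).
have : `|(Q n.+1)%:~R * theta n - (Q n)%:~R * theta n.+1| = 1.
  rewrite (_ : _ - _ = - (-1) ^+ n.+1) ?normrN ?normrX ?normrN1 ?expr1n //.
  have /(congr1 (fun z : int => z%:~R : R)) := cf_det a n.
  rewrite rmorphB !rmorphM rmorphXn rmorphN /= => <-.
  rewrite /theta -/P -/Q; ring.
have -> : (Q n.+1)%:~R * theta n - (Q n)%:~R * theta n.+1 =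
    ((Q n.+1)%:~R + (Q n)%:~R / x n.+2) * theta n.
  by rewrite thetaS; ring.
have D0 : 0 < (Q n)%:~R / x n.+2 by rewrite divr_gt0.
rewrite normrM gtr0_norm ?addr_gt0 // => e; rewrite -[leRHS]e.
by rewrite ler_wpM2r // lerDl ltW.
Qed.

End ContinuedFraction.

(** * Boundedness and non-recurrence for a counterexample *)

Section Counterexample.
Variables (R : realType) (alpha : R) (d : nat -> nat).
Hypothesis hd : forall k : nat, (1 <= k)%N -> (2 <= d k)%N.
Hypothesis hc : mixed_littlewood_counterexample alpha d.

Lemma counterexample_irrational : irrational alpha.
Proof.
move=> q p q0; have [c c0 H] := counterexample_bound hc.
have := H q p 0%N q0; rewrite /partial_prod big_geq // dvd1n => /(_ isT).
by apply: contraTneq => ->; rewrite subrr normr0 mulr0 mul0r -ltNge.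
Qed.

Let a := partial_quotient alpha.
Let P := cf_num a.
Let Q := cf_den a.
Let a1 i : (0 < i)%N -> 1 <= a i.
Proof. exact/partial_quotient_ge1/counterexample_irrational. Qed.
Let Q0 k : 0 < (Q k)%:~R :> R.
Proof. by rewrite ltr0z cf_den_gt0. Qed.

(** Since [a_(l+1) Q_l <= Q_(l+1)], the bounds [c <= Q_l |theta_l|] and [Q_(l+1) |theta_l| <= 1]
    give [a_(l+1) <= 1/c]. *)
Lemma counterexample_bounded : exists B : nat,
  forall l, (0 < l)%N -> 0 <= partial_quotient alpha l < B%:Z.
Proof.
have [c c0 H] := counterexample_bound hc.
exists (Num.truncn c^-1).+1 => -[//|l] _.
apply/andP; split; first by rewrite (le_trans _ (a1 _)).
have := H (Q l) (P l) 0%N; rewrite /partial_prod big_geq // dvd1n divr1.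
rewrite gtr0_norm // gt_eqF ?cf_den_gt0 // => /(_ isT isT) cle.
have aQ : (a l.+1)%:~R * (Q l)%:~R <= (Q l.+1)%:~R :> R.
  rewrite -rmorphM /= ler_int; case: (l) => [|k].
    by rewrite /Q cf_den1 mulr1.
  by rewrite /Q cf_denSS lerDl ltW // cf_den_gt0.
have h : (a l.+1)%:~R <= c^-1.
  rewrite -[c^-1]mul1r ler_pdivlMr //.
  apply: le_trans (cf_den_approx counterexample_irrational l).
  apply: (le_trans (ler_wpM2l _ cle)).
    by rewrite ler0z (le_trans _ (a1 _)).
  by rewrite mulrA ler_wpM2r.
rewrite -(ltr_int R); apply: (le_lt_trans h).
by rewrite -pmulrn truncnS_gt.
Qed.

(* w is the combination of the denominators m+n and m+n+1 whose coefficients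
   make it vanish at the pair (Q m, Q m.+1), hence modulo e at a return. *)
Lemma counterexample_not_recurrent m :
  ~ recurrent_from (partial_quotient alpha) m.+2.
Proof.
move=> rec; have [c c0 H] := counterexample_bound hc.
pose C : R := (Q m)%:~R + (Q m.+1)%:~R.
have C0 : 0 < C by rewrite addr_gt0.
(* [C] does not depend on [N], so the left side outgrows the right. *)
suff B N : (0 < N)%N -> c * (2 ^ N)%:R <= C ^+ 2.
  pose N := (Num.truncn (C ^+ 2 / c)).+1.
  have : c * N%:R <= C ^+ 2.
    apply: le_trans (B N isT); rewrite ler_wpM2l ?(ltW c0) // ler_nat.
    by rewrite ltnW // ltn_expl.
  by rewrite mulrC -ler_pdivlMr // leNgt truncnS_gt.
move=> N0; have eN : (2 ^ N <= partial_prod d N)%N := partial_prod_ge N hd.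
have e1 : (1 < partial_prod d N)%N.
  by apply: leq_trans eN; rewrite -{1}(expn0 2) ltn_exp2l.
have [n n0] := cf_den_return e1 rec.
set w := (X in `|X|%N) => edvd.
pose w' := cf_den a m * cf_num a (m + n).+1 - cf_den a m.+1 * cf_num a (m + n).
(* If [w] were 0, coprimality of consecutive denominators would make [Q (m + n).+1] divide the
   smaller positive [Q m.+1]. *)
have w0 : w != 0.
  apply/negP; rewrite subr_eq0 => /eqP weq.
  have weq' : Q m.+1 = Q (m + n).+1 *
      ((-1) ^+ (m + n).+1 * (Q m.+1 * P (m + n) - Q m * P (m + n).+1)).
    rewrite mulrCA mulrBr mulrCA [Q _.+1 * (Q m * _)]mulrA [Q _.+1 * Q m]mulrC.
    by rewrite weq -mulrA -mulrBr cf_det mulrCA -exprMn mulrNN mulr1 expr1n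
      mulr1.
  have Qlt : Q m.+1 < Q (m + n).+1.
    by apply: cf_den_lt; rewrite // -ltn_subLR // subnn.
  have : 0 < Q m.+1 by apply: cf_den_gt0.
  rewrite {1}weq' pmulr_rgt0 ?cf_den_gt0 // gtz0_ge1 => z1.
  by move: Qlt; rewrite weq' ltNge ler_peMr // ltW // cf_den_gt0.
have Qle : (Q (m + n))%:~R <= (Q (m + n).+1)%:~R :> R.
  by rewrite ler_int cf_den_leS.
have Qle' : (Q (m + n).+1)%:~R <= (Q (m + n).+2)%:~R :> R.
  by rewrite ler_int cf_den_leS.
(* The factor [Q (m + n).+1] in this bound cancels against the one in [tle], leaving [C ^+ 2]. *)
have wle : `|w%:~R| <= C * (Q (m + n).+1)%:~R.
  rewrite rmorphB !rmorphM /=; apply: (le_trans (ler_normB _ _)).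
  rewrite !normrM !(gtr0_norm (Q0 _)) mulrDl lerD2l.
  by apply: ler_wpM2l => //; apply: ltW.
have tle : (Q (m + n).+1)%:~R * `|w%:~R * alpha - w'%:~R| <= C.
  have t k : (Q (m + n).+1 <= Q k.+1) ->
      (Q (m + n).+1)%:~R * `|(Q k)%:~R * alpha - (P k)%:~R| <= 1.
    move=> le; apply: le_trans (cf_den_approx counterexample_irrational k).
    by rewrite ler_wpM2r // ler_int.
  have -> : w%:~R * alpha - w'%:~R =
     (Q m)%:~R * ((Q (m + n).+1)%:~R * alpha - (P (m + n).+1)%:~R) -
     (Q m.+1)%:~R * ((Q (m + n))%:~R * alpha - (P (m + n))%:~R).
    by rewrite !rmorphB !rmorphM /= /Q /P; ring.
  apply: (le_trans (ler_wpM2l _ (ler_normB _ _))); first exact: ltW.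
  rewrite !normrM (gtr0_norm (Q0 m)) (gtr0_norm (Q0 m.+1)).
  rewrite mulrDr !(mulrCA (Q (m + n).+1)%:~R) lerD //.
    by rewrite -[X in _ <= X]mulr1 ler_wpM2l ?(ltW (Q0 _)) // t ?cf_den_leS.
  by rewrite -[X in _ <= X]mulr1 ler_wpM2l ?(ltW (Q0 _)) // t.
have eR0 : 0 < (partial_prod d N)%:R :> R by rewrite ltr0n ltnW.
have := H w w' N w0 edvd; rewrite (ler_pdivlMr _ _ eR0) => cle.
apply: (@le_trans _ _ (c * (partial_prod d N)%:R)).
  by rewrite ler_wpM2l ?(ltW c0) // ler_nat.
apply: (le_trans cle); apply: (le_trans (ler_wpM2r _ wle)) => //.
by rewrite -mulrA expr2 ler_wpM2l ?(ltW C0).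
Qed.

End Counterexample.
Unset Implicit Arguments.

(** * Growth of the complexity *)

Theorem corollary2p4 (R : realType) (alpha : R) (d : nat -> nat)
    (hd : forall k : nat, (1 <= k)%N -> (2 <= d k)%N)
    (hcounter : mixed_littlewood_counterexample alpha d) :
  ((complexity n alpha)%:R - n%:R : R) @[n --> \oo] --> +oo.
Proof.
have blocksE n : blocks alpha n = factors (partial_quotient alpha) 1 n.
  apply/seteqP; split=> [_ [l _ <-]|_ [[//|l] _ <-]].
    exists l.+1 => //; apply: eq_from_tnth => i.
    by rewrite !tnth_mktuple addSnnS.
  exists l => //; apply: eq_from_tnth => i.
  by rewrite !tnth_mktuple addSnnS.
have [B aB] := counterexample_bounded hcounter.
have H : forall K, exists n0, forall n, (n0 <= n)%N ->
    (n + K <= #|` fset_set (factors (partial_quotient alpha) 1 n)|)%N.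
  (* The threshold 1 matches non-recurrence, which is known at positions [m.+2]. *)
  apply: (@card_factors_unbounded _ _ 1) => [N n N0|[//|[//|m]] _].
    by apply: (@factors_bounded _ B) => l lN; apply: aB; apply: leq_trans lN.
  exact: (counterexample_not_recurrent hd hcounter).
apply/cvgryPge => A.
have [n0 n0P] := H (Num.truncn A).+1.
exists n0 => // n /= n0n; rewrite /complexity blocksE lerBrDl.
apply: (@le_trans _ _ (n%:R + (Num.truncn A).+1%:R)).
  by rewrite lerD2l ltW // truncnS_gt.
by rewrite -natrD ler_nat n0P.
Qed.
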